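(* For any probability measure $\sigma$ with $\sigma([0,1])=1$ and density essentially bounded by $M$, and for any $m\in\mathbb{N}$, $$\lambda_1^{(m)}\ge\frac{1}{\left\lceil 75e^4(2m-1)M(12eM)^{2m-2}\right\rceil}.$$
   Context: $\mathbb{N}=\{1,2,\dots\}$. For $m\in\mathbb{N}$ and a probability measure $\sigma$ on $\mathbb{R}$ with $\int|x|^{2m-1}d\sigma(x)<\infty$ which is not purely atomic with less than $m$ atoms, the Gaussian quadrature formula of $\sigma$ with $m$ nodes is the unique system of nodes $\xi_1^{(m)}<\xi_2^{(m)}<\cdots<\xi_m^{(m)}$ and positive weights $(\lambda_i^{(m)})_{i=1}^m$ satisfying $\sum_{i=1}^m\lambda_i^{(m)}(\xi_i^{(m)})^j=\int x^j d\sigma(x)$ for all $0\le j\le 2m-1$. Thus $\lambda_1^{(m)}$ is the weight of the smallest node. *)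

(* Defs.v *)
From HB Require Import structures.
From mathcomp Require Import all_boot all_order all_algebra.
From mathcomp Require Import all_classical all_reals all_analysis.

Set Implicit Arguments.
Unset Strict Implicit.
Unset Printing Implicit Defensive.

Import Order.TTheory GRing.Theory Num.Theory.
Import numFieldNormedType.Exports.

Local Open Scope classical_set_scope.
Local Open Scope ring_scope.

Definition has_density (R : realType) (sigma : probability (measurableTypeR R) R)
    (f : measurableTypeR R -> R) : Prop :=
  [/\ measurable_fun [set: measurableTypeR R] f,
      forall x, 0 <= f x &
      forall A : set (measurableTypeR R), measurable A ->
        sigma A = (\int[@lebesgue_measure R]_(x in A) (f x)%:E)%E].

Definition density_ess_bounded (R : realType)
    (sigma : probability (measurableTypeR R) R) (M : R) : Prop :=
  exists2 f, has_density sigma f & {ae @lebesgue_measure R, forall x, f x <= M}.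

(* Nodes and weights are indexed from 0.  An extended-real integral is finite
   only when the integrand is integrable, so the last clause also forces the
   moments of order at most 2m-1 to exist.  For m > 0, the bound j < 2 * m is
   j <= 2m-1. *)
Definition gaussian_quadrature (R : realType)
    (sigma : probability (measurableTypeR R) R) (m : nat)
    (xi lambda : 'I_m -> R) : Prop :=
  [/\ forall i j : 'I_m, (i < j)%N -> xi i < xi j,
      forall i : 'I_m, 0 < lambda i &
      forall j : nat, (j < 2 * m)%N ->
        (\sum_(i < m) lambda i * xi i ^+ j)%:E =
        (\int[sigma]_(x in [set: measurableTypeR R]) (x ^+ j)%:E)%E].

(* Main.v *)
(* Let p be the Lagrange basis polynomial of a node xi_i and n = m - 1.  The
   quadrature is exact on p^2, x p^2 and (1 - x) p^2, so lambda_i is the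
   integral of p^2 and xi_i lies in [0,1].  Put d = 1/(mM).  If |p| <= s on
   points x_0, ..., x_n of [0,1] with gaps at least d, then Lagrange
   interpolation at these points gives 1 = |p(xi_i)| <= s L with
   L = (2/d)^n / n!, so there are no such points when s = 1/(2L).  The set
   where |p| <= s is then covered by n intervals of length d, each of mass at
   most M d = 1/m, so p^2 > s^2 on a set of mass at least 1/m.  Hence
   lambda_i >= s^2/m = 1/(4 m L^2), and m^n / n! <= e^m turns this into a bound
   stronger than the claimed one. *)
Require Import Defs.
From HB Require Import structures.
From mathcomp Require Import all_boot all_order all_algebra.
From mathcomp Require Import all_classical all_reals all_analysis.
From mathcomp Require Import measurable_realfun ring lra zify.

Import Order.TTheory GRing.Theory Num.Theory.
Import numFieldNormedType.Exports.
Local Open Scope classical_set_scope.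
Local Open Scope ring_scope.

Set Implicit Arguments.
Unset Strict Implicit.

(** * Mass bounds from an essentially bounded density *)

(** The sign of [M] is not known here; [Num.max M 0] keeps the constant nonnegative, as comparing
    integrals of nonnegative functions requires. *)
Lemma density_ess_bounded_le (R : realType)
    (sigma : probability (measurableTypeR R) R) (M : R)
    (A : set (measurableTypeR R)) :
  density_ess_bounded sigma M -> measurable A ->
  (sigma A <= (Num.max M 0)%:E * @lebesgue_measure R A)%E.
Proof.
move=> [f [mf f0 sigmaE] fM] mA; rewrite sigmaE //.
rewrite -integral_cst //; apply: ae_ge0_le_integral => //.
- by move=> x _; rewrite lee_fin.
- by apply/measurable_EFinP; exact: measurable_funTS.
- by move=> x _; rewrite /cst lee_fin le_max lexx orbT.
- by apply: filterS fM => x fxM _; rewrite /cst lee_fin le_max fxM.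
Qed.

Lemma density_ess_bounded_itv (R : realType)
    (sigma : probability (measurableTypeR R) R) (M a d : R) :
  density_ess_bounded sigma M -> 0 <= d ->
  (sigma `[a, (a + d)%R]%classic <= (Num.max M 0 * d)%:E)%E.
Proof.
move=> sM d0; apply: le_trans (density_ess_bounded_le sM _) _ => //.
rewrite EFinM lee_wpmul2l ?lee_fin ?le_max ?lexx ?orbT //.
rewrite lebesgue_measure_itv /= lte_fin.
case: ifP => _; last by rewrite lee_fin.
by rewrite -EFinB lee_fin addrAC subrr add0r.
Qed.

(** An interval of length 1 carries all the mass, so [1 <= Num.max M 0], and the maximum must then
    be [M]. *)
Lemma density_ess_bounded_ge1 (R : realType)
    (sigma : probability (measurableTypeR R) R) (M : R) :
  sigma `[0, 1]%classic = 1%E -> density_ess_bounded sigma M -> 1 <= M.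
Proof.
move=> s01 /density_ess_bounded_itv /(_ ler01) => /(_ 0).
by rewrite add0r s01 mulr1 lee_fin le_max ler10 orbF.
Qed.

(** * Moments and exactness of the quadrature on [0,1] *)

Lemma integrable_pow01 (R : realType)
    (sigma : probability (measurableTypeR R) R) (j : nat) :
  sigma.-integrable `[0, 1]%classic (fun x => (x ^+ j)%:E).
Proof.
set I : set (measurableTypeR R) := `[0, 1]%classic.
have mI : measurable I by exact: measurable_itv.
have := @measurable_bounded_integrable _ _ R sigma
  (fun x : measurableTypeR R => (x : R) ^+ j) I.
apply => //.
  by apply: le_lt_trans (probability_le1 sigma mI) _; rewrite ltry.
exists 1; split=> // B B1 x /=; rewrite /I /= in_itv /= => /andP[x0 x1].
by rewrite normrX (le_trans _ (ltW B1)) // exprn_ile1 // ger0_norm.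
Qed.

(** The complement of [0,1] is null, so dropping it affects neither integrability nor the value. *)
Lemma integral_pow_setT (R : realType)
    (sigma : probability (measurableTypeR R) R) (j : nat) :
  sigma `[0, 1]%classic = 1%E ->
  (\int[sigma]_(x in setT) (x ^+ j)%:E =
   \int[sigma]_(x in `[0%R, 1%R]%classic) (x ^+ j)%:E)%E.
Proof.
move=> s01; set I : set (measurableTypeR R) := `[0%R, 1%R]%classic.
have mI : measurable I by exact: measurable_itv.
have sIC : sigma (~` I) = 0%E.
  by rewrite probability_setC // [X in (_ - X)%E]s01 subee.
have mC : measurable (~` I) by exact: measurableC.
have mX : measurable_fun setT (fun x : measurableTypeR R => (x ^+ j)%:E).
  by apply/measurable_EFinP; exact: measurable_funX.
rewrite (negligible_integral mC) ?setTD ?setCK //.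
apply/(negligible_integrable mC) => //.
by rewrite setTD setCK; exact: integrable_pow01.
Qed.

(** Exactness on monomials extends by linearity; [size p <= 2 * m] says that the degree is at most
    2m-1. *)
Lemma quadrature_integral01 (R : realType)
    (sigma : probability (measurableTypeR R) R) (m : nat)
    (xi lambda : 'I_m -> R) (p : {poly R}) :
  sigma `[0, 1]%classic = 1%E -> gaussian_quadrature sigma xi lambda ->
  (size p <= 2 * m)%N ->
  (\int[sigma]_(x in `[0%R, 1%R]%classic) (p.[x])%:E =
   (\sum_(i < m) lambda i * p.[xi i])%:E)%E.
Proof.
move=> s01 [_ _ quad] sp.
set I : set (measurableTypeR R) := `[0%R, 1%R]%classic.
have mI : measurable I by exact: measurable_itv.
under eq_integral do rewrite (horner_coef_wide _ sp) -sumEFin.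
rewrite integral_sum //; last first.
  by move=> j; exact: (integrableZl mI p`_j (integrable_pow01 sigma j)).
transitivity (\sum_(j < 2 * m)
    (p`_j * \sum_(i < m) lambda i * xi i ^+ j)%:E)%E.
  apply: eq_bigr => j _; under eq_integral do rewrite EFinM.
  rewrite integralZl //; last exact: integrable_pow01.
  by rewrite -(integral_pow_setT j s01) -quad.
rewrite sumEFin; congr EFin.
under eq_bigr do rewrite mulr_sumr.
rewrite exchange_big; apply: eq_bigr => i _.
rewrite (horner_coef_wide _ sp) mulr_sumr.
by apply: eq_bigr => j _; rewrite mulrCA.
Qed.

(** * Lagrange interpolation at separated points *)

(** The factors with j < i multiply to i!, those with j > i to (n-i)!. Up to sign this is the
    Lagrange denominator for unit spacing. *)
Lemma prod_dist_ord (n : nat) (i : 'I_n.+1) :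
  (\prod_(j < n.+1 | j != i) `|i - j| = i`! * (n - i)`!)%N.
Proof.
have le_in : (i <= n)%N by rewrite -ltnS.
rewrite (eq_bigl (fun j : 'I_n.+1 => (j : nat) != i)) //.
rewrite -(big_mkord (fun j => j != i) (fun j => `|i - j|%N)).
rewrite (@big_cat_nat _ _ _ i) //=; last exact: ltnW.
rewrite [X in (_ * X)%N]big_ltn_cond // eqxx /=; congr (_ * _)%N.
  rewrite big_nat_rev fact_prod big_add1 /= add0n.
  rewrite big_nat_cond big_mkcond [RHS]big_nat_cond [RHS]big_mkcond /=.
  by apply: eq_bigr => j _; case: ifP; case: ifP; rewrite ?andbT; lia.
rewrite fact_prod big_add1 [RHS]big_add1 /= -[X in index_iota X]add0n big_addn.
rewrite big_nat_cond [RHS]big_nat_cond big_mkcond [RHS]big_mkcond /=.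
by apply: eq_bigr => j _; case: ifP; case: ifP; lia.
Qed.

Lemma chain_dist (R : realDomainType) (d : R) (x : nat -> R) :
  (forall i, x i + d <= x i.+1) ->
  forall i j : nat, `|i - j|%N%:R * d <= `|x i - x j|.
Proof.
move=> xd.
have le_dist i k : k%:R * d <= x (k + i)%N - x i.
  elim: k => [|k IH]; first by rewrite mul0r subrr.
  by rewrite addSn -natr1; have := xd (k + i)%N; move: IH; lra.
move=> i j; wlog le_ij : i j / (i <= j)%N.
  move=> H; case/orP: (leq_total i j) => [/H//|/H].
  by rewrite distnC distrC.
rewrite distrC distnEr //; apply: le_trans (ler_norm _).
by rewrite -{2}(subnK le_ij); apply: le_dist.
Qed.

(* The Lagrange basis polynomial at x_i is at most r^n / (d^n i! (n-i)!) at y,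
   and the sum over i of 1 / (i! (n-i)!) is 2^n / n!. *)
Lemma lagrange_bound (R : realFieldType) (n : nat) (d r s : R) (x : nat -> R)
    (p : {poly R}) (y : R) :
  0 < d -> (forall i, x i + d <= x i.+1) -> (size p <= n.+1)%N ->
  (forall i, (i <= n)%N -> `|p.[x i]| <= s) ->
  (forall i, (i <= n)%N -> `|y - x i| <= r) ->
  `|p.[y]| <= s * ((2 * r / d) ^+ n / n`!%:R).
Proof.
move=> d0 xd sp ps yr.
have x_inj : injective x.
  move=> i j xij; apply/eqP; rewrite -distn_eq0 -leqn0 -(ler_nat R).
  rewrite -(ler_pM2r d0); apply: le_trans (chain_dist xd i j) _.
  by rewrite xij subrr normr0 mul0r.
rewrite {1}(lagrange_gen (ltn0Sn n) x_inj sp) horner_sum.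
apply: le_trans (ler_norm_sum _ _ _) _.
have r0 : 0 <= r by exact: le_trans (normr_ge0 (y - x 0%N)) (yr 0%N (leq0n n)).
have term (i : 'I_n.+1) :
    `|((p.[x i])%:P * tnth (n.+1.-lagrange x) i).[y]| <=
    s * (r / d) ^+ n / n`!%:R * ('C(n, i))%:R.
  have le_in : (i <= n)%N by rewrite -ltnS.
  have pos_fact k : 0 < k`!%:R :> R by rewrite ltr0n fact_gt0.
  have fact_neq k : k`!%:R != 0 :> R by rewrite gt_eqF.
  rewrite lagrangeE // !hornerM !hornerC !horner_prod.
  rewrite !normrM normfV !normr_prod.
  have card_j : #|[pred j : 'I_n.+1 | j != i]| = n.
    by have := cardC1 i; rewrite card_ord.
  have num : \prod_(j < n.+1 | j != i) `|('X - (x j)%:P).[y]| <= r ^+ n.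
    rewrite -[n in r ^+ n]card_j -prodr_const; apply: ler_prod => j _.
    by rewrite !hornerE normr_ge0 yr // -ltnS.
  have den : d ^+ n * (i`! * (n - i)`!)%N%:R <=
      \prod_(j < n.+1 | j != i) `|('X - (x j)%:P).[x i]|.
    rewrite -prod_dist_ord natr_prod mulrC -[n in d ^+ n]card_j -prodr_const.
    rewrite -big_split /=; apply: ler_prod => j _.
    by rewrite !hornerE mulr_ge0 ?ler0n ?(ltW d0) // chain_dist.
  (* The identity n! = C(n,i) i! (n-i)! trades the factorials for a binomial coefficient, whose sum
     over i is 2^n. *)
  have -> : s * (r / d) ^+ n / n`!%:R * ('C(n, i))%:R =
      s * ((d ^+ n * (i`! * (n - i)`!)%N%:R)^-1 * r ^+ n).
    rewrite -(bin_fact le_in) expr_div_n !natrM.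
    have C0 : ('C(n, i))%:R != 0 :> R by rewrite pnatr_eq0 -lt0n bin_gt0.
    have dn0 : d ^+ n != 0 by rewrite expf_neq0 // gt_eqF.
    by field; rewrite dn0 C0 !fact_neq.
  have den0 : 0 < d ^+ n * (i`! * (n - i)`!)%N%:R.
    by rewrite mulr_gt0 ?exprn_gt0 // ltr0n muln_gt0 !fact_gt0.
  apply: ler_pM => //; first by rewrite mulr_ge0 ?invr_ge0 ?prodr_ge0.
    exact: ps.
  apply: ler_pM => //; first by rewrite invr_ge0 prodr_ge0.
    by rewrite prodr_ge0.
  by rewrite lef_pV2 // posrE (lt_le_trans den0).
apply: le_trans (ler_sum _ (fun i _ => term i)) _.
rewrite -mulr_sumr -natr_sum.
have -> : (\sum_(i < n.+1) 'C(n, i) = 2 ^ n)%N.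
  rewrite -[2%N]/(1 + 1)%N expnDn; apply: eq_bigr => i _.
  by rewrite !exp1n !muln1.
rewrite natrX -[2 * r / d]mulrA [(2 * _) ^+ n]exprMn mulrAC -!mulrA.
by rewrite (mulrCA (2 ^+ n)).
Qed.

(** * Separated points in a set of large mass *)

(* Greedy choice: split off the first interval [inf E, inf E + d] and recurse
   on the part of E to the right of it. *)
Lemma separated_points_or_small (R : realType)
    (mu : {measure set (measurableTypeR R) -> \bar R}) (d c : R) :
  0 <= c -> (forall a : R, (mu `[a, (a + d)%R]%classic <= c%:E)%E) ->
  forall (n : nat) (E : set (measurableTypeR R)),
  measurable E -> has_lbound (E : set R) ->
  (exists2 x : nat -> R, (forall i, x i + d <= x i.+1) &
     forall i, (i <= n)%N -> E (x i)) \/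
  (mu E <= (c *+ n)%:E)%E.
Proof.
move=> c0 small; elim=> [|n IH] E mE lbE.
  have [->|/set0P[x Ex]] := eqVneq E set0; first by right; rewrite measure0.
  (* Only index 0 has to lie in [E]; the later points merely continue the sequence with gap d. *)
  left; exists (fun i => x + i%:R * d); last by case=> //; rewrite mul0r addr0.
  by move=> i; rewrite -natr1; lra.
have [->|E0] := eqVneq E set0.
  by right; rewrite measure0 lee_fin mulrn_wge0.
pose a := inf (E : set R).
pose F : set (measurableTypeR R) := E `&` `]a + d, +oo[.
have mF : measurable F by apply: measurableI => //; exact: measurable_itv.
have lbF : has_lbound (F : set R).
  by case: lbE => b lb; exists b => x [/lb].
case: (IH F mF lbF) => [[y ydy Fy]|muF].
  (* The infimum [a] need not belong to [E], but [y 0] lies strictly beyond [a + d], which leaves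
     room for a point of [E] close to [a]. *)
  left; have [x Ex xy] : exists2 x : R, E x & x + d <= y 0%N.
    have [_] := Fy 0%N (leq0n n); rewrite /= in_itv /= andbT => ady.
    have e0 : 0 < y 0%N - d - a by lra.
    have [//|x Ex xlt] := inf_adherent e0 (conj _ lbE); first exact/set0P.
    by exists x => //; move: xlt; rewrite -/a; lra.
  exists (fun i => if i is k.+1 then y k else x); first by case.
  by case=> // i; rewrite ltnS => /Fy[].
right; have -> : E = (E `&` `[a, a + d]) `|` F.
  rewrite -setIUr; apply/seteqP; split=> [x Ex|x []//]; split=> //=.
  have : a <= x by exact: ge_inf.
  move=> ax; have [xa|xa] := lerP x (a + d); [left|right].
    by rewrite in_itv /= ax.
  by rewrite in_itv /= xa.
have mEa : measurable (E `&` `[a, a + d]).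
  by apply: measurableI => //; exact: measurable_itv.
apply: le_trans; first exact: (measureU2 mu mEa mF).
rewrite mulrS EFinD; apply: leeD => //.
apply: le_trans (small a); apply: (le_measure mu); rewrite ?inE //.
Qed.

(** * Location of the nodes and a lower bound for the weights *)

(* p is the Lagrange basis polynomial of the node xi i. *)
Lemma quadrature_node_poly (R : realType)
    (sigma : probability (measurableTypeR R) R) (m : nat)
    (xi lambda : 'I_m -> R) (i : 'I_m) :
  sigma `[0, 1]%classic = 1%E -> gaussian_quadrature sigma xi lambda ->
  exists p : {poly R}, [/\ (size p <= m)%N, p.[xi i] = 1 &
    forall g : {poly R}, (size g <= 2)%N ->
    (\int[sigma]_(x in `[0%R, 1%R]%classic) (p.[x] ^+ 2 * g.[x])%:E =
     (lambda i * g.[xi i])%:E)%E].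
Proof.
move=> s01 quad; have [xi_lt _ _] := quad.
have xi_neq j : j != i -> xi i - xi j != 0.
  move=> ji; rewrite subr_eq0; have : (i != j :> nat) by rewrite eq_sym.
  by rewrite neq_ltn => /orP[]/xi_lt; [move/lt_eqF->|move/gt_eqF->].
pose P := \prod_(j < m | j != i) ('X - (xi j)%:P).
have Pi : P.[xi i] != 0.
  rewrite horner_prod prodf_seq_neq0; apply/allP => j _; apply/implyP => ji.
  by rewrite !hornerE xi_neq.
have Pj j : j != i -> P.[xi j] = 0.
  by move=> ji; rewrite horner_prod (bigD1 j) //= !hornerE subrr mul0r.
have m0 : (0 < m)%N by exact: leq_ltn_trans (leq0n i) (ltn_ord i).
have sP : (size P <= m)%N.
  apply: leq_trans (size_poly_prod_leq _ _) _.
  under eq_bigr do rewrite size_XsubC.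
  by rewrite sum_nat_const; have := cardC1 i; rewrite card_ord => ->; lia.
pose p : {poly R} := P.[xi i]^-1 *: P.
have sp : (size p <= m)%N by exact: leq_trans (size_scale_leq _ _) sP.
have pi : p.[xi i] = 1 by rewrite hornerZ mulVf.
have pj j : j != i -> p.[xi j] = 0.
  by move=> /Pj Pj0; rewrite hornerZ Pj0 mulr0.
exists p; split => // g sg.
(* The degree is at most 2(m-1) + 1 = 2m-1, just within the range of exactness. *)
have spg : (size (p ^+ 2 * g)%R <= 2 * m)%N.
  apply: leq_trans (size_polyMleq _ _) _.
  have := size_polyMleq p p; rewrite -expr2.
  move: (size (p ^+ 2)) (size p) (size g) sp sg m0 => a b c; lia.
have := quadrature_integral01 s01 quad spg.
under eq_integral do rewrite hornerM horner_exp.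
move=> ->; congr EFin; rewrite (bigD1 i) //= big1 ?addr0.
  by rewrite hornerM horner_exp pi expr1n mul1r.
by move=> j /pj pj0; rewrite hornerM horner_exp pj0 expr0n mul0r mulr0.
Qed.

(** An affine [g] that is nonnegative on [0,1] is nonnegative at the node, because the weight is
    positive. Apply this to X and 1 - X. *)
Lemma quadrature_node01 (R : realType)
    (sigma : probability (measurableTypeR R) R) (m : nat)
    (xi lambda : 'I_m -> R) (i : 'I_m) :
  sigma `[0, 1]%classic = 1%E -> gaussian_quadrature sigma xi lambda ->
  0 <= xi i <= 1.
Proof.
move=> s01 quad; have [_ /(_ i) l0 _] := quad.
have [p [_ _ int_p]] := quadrature_node_poly i s01 quad.
have nonneg (g : {poly R}) : (size g <= 2)%N ->
    (forall x, 0 <= x <= 1 -> 0 <= g.[x]) -> 0 <= g.[xi i].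
  move=> sg g0; rewrite -(pmulr_rge0 _ l0) -lee_fin -int_p //.
  apply: integral_ge0 => x /=; rewrite in_itv /= => /g0 gx.
  by rewrite lee_fin mulr_ge0 // sqr_ge0.
apply/andP; split.
  have := nonneg 'X; rewrite size_polyX hornerX; apply=> // x.
  by rewrite hornerX => /andP[].
have := nonneg (1 - 'X); rewrite !hornerE subr_ge0; apply.
  by rewrite -opprB size_polyN size_XsubC.
by move=> x; rewrite !hornerE subr_ge0 => /andP[].
Qed.

Lemma quadrature_weight_lower (R : realType)
    (sigma : probability (measurableTypeR R) R) (M : R) (n : nat)
    (xi lambda : 'I_n.+1 -> R) (i : 'I_n.+1) :
  sigma `[0, 1]%classic = 1%E -> density_ess_bounded sigma M ->
  gaussian_quadrature sigma xi lambda ->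
  (4 * n.+1%:R * ((2 * (n.+1%:R * M)) ^+ n / n`!%:R) ^+ 2)^-1 <= lambda i.
Proof.
move=> s01 sM quad.
have M1 := density_ess_bounded_ge1 s01 sM.
have M0 : 0 < M by apply: lt_le_trans M1.
have m0 : 0 < n.+1%:R :> R by rewrite ltr0n.
set L := _ / n`!%:R.
have L0 : 0 < L.
  by rewrite divr_gt0 ?ltr0n ?fact_gt0 // exprn_gt0 // !mulr_gt0.
(* With this length, an interval has mass at most M d = 1/m, where m = n+1. *)
pose d := (n.+1%:R * M)^-1.
have d0 : 0 < d by rewrite invr_gt0 mulr_gt0.
have [p [sp p1 int_p]] := quadrature_node_poly i s01 quad.
have /andP[xi0 xi1] := quadrature_node01 i s01 quad.
(* Half of 1/L, so that interpolation at separated points of [E] would give 1 <= s L = 1/2. *)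
pose s := (2 * L)^-1.
have s0 : 0 < s by rewrite invr_gt0 mulr_gt0.
pose I := (`[0%R, 1%R]%classic : set (measurableTypeR R)).
have mI : measurable I by exact: measurable_itv.
pose E := I `&` (fun x : measurableTypeR R => `|p.[x]|) @^-1` `]-oo, s].
have mE : measurable E.
  apply: measurableI => //; rewrite -[X in measurable X]setTI.
  have mp : measurable_fun (setT : set (measurableTypeR R)) (fun x => `|p.[x]|).
    by apply: measurableT_comp => //; exact: measurable_poly.
  by apply: mp => //; exact: measurable_itv.
have E01 (z : R) : E z -> 0 <= z <= 1 by case; rewrite /= in_itv.
have lbE : has_lbound (E : set R).
  by exists 0 => x /E01 /andP[].
have small a : (sigma `[a, (a + d)%R]%classic <= (n.+1%:R^-1)%:E)%E.
  apply: le_trans (density_ess_bounded_itv a sM (ltW d0)) _.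
  rewrite (max_idPl (ltW M0)) /d invfM mulrCA divff ?mulr1 //.
  by rewrite gt_eqF.
have c0 : 0 <= n.+1%:R^-1 :> R by rewrite invr_ge0 ltW.
have [[x xd Ex]|sE] := separated_points_or_small c0 small n mE lbE.
  exfalso.
  have ps k : (k <= n)%N -> `|p.[x k]| <= s.
    by move=> /Ex[_] /=; rewrite in_itv.
  have yr k : (k <= n)%N -> `|xi i - x k| <= 1.
    by move=> /Ex /E01 /andP[x0 x1]; rewrite ler_norml; lra.
  have := lagrange_bound d0 xd sp ps yr.
  rewrite p1 normr1 mulr1 /d invrK -/L /s invfM mulfVK ?gt_eqF //.
  by lra.
have sI : sigma I = 1%E by [].
have EI : E `<=` I by move=> x [].
(* What remains is at least 1 - n/(n+1) = 1/(n+1). *)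
have sIE : ((n.+1%:R^-1)%:E <= sigma (I `\` E))%E.
  rewrite measureD //; last first.
    by apply: le_lt_trans (probability_le1 sigma mI) _; rewrite ltry.
  rewrite [X in (X - _)%E]sI setIidr //.
  apply: (@le_trans _ _ (1 - (n.+1%:R^-1 *+ n)%:E)%E); last exact: leeB.
  rewrite -EFinB lee_fin -[_^-1 *+ n]mulr_natr.
  have -> : n%:R = n.+1%:R - 1 :> R by rewrite -natr1 addrK.
  by rewrite mulrBr mulVf ?gt_eqF // mulr1 opprB addrCA subrr addr0.
have mIE : measurable (I `\` E) by exact: measurableD.
have : (lambda i)%:E = (\int[sigma]_(x in I) (p.[x] ^+ 2)%:E)%E.
  have := int_p 1; rewrite size_poly1 hornerE mulr1 => <- //.
  by apply: eq_integral => x _; rewrite hornerE mulr1.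
have mp2 : measurable_fun I (fun x => (p.[x] ^+ 2)%:E).
  apply/measurable_EFinP/measurable_funX.
  exact: measurable_poly.
move=> lE.
(* A Chebyshev-type estimate: p^2 exceeds s^2 off [E]. *)
have : ((s ^+ 2)%:E * sigma (I `\` E) <= (lambda i)%:E)%E.
  rewrite lE -integral_cst //.
  apply: (@le_trans _ _ (\int[sigma]_(x in I `\` E) (p.[x] ^+ 2)%:E)%E).
    apply: ge0_le_integral => //.
    - by move=> x _; rewrite lee_fin sqr_ge0.
    - by apply: measurable_funS mp2 => // x [].
    move=> x [Ix nEx]; rewrite lee_fin -[leRHS]real_normK ?num_real //.
    rewrite lerXn2r ?nnegrE ?(ltW s0) // leNgt; apply/negP => ps.
    by apply: nEx; split => //=; rewrite in_itv /= ltW.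
  by apply: ge0_subset_integral => // x _; rewrite lee_fin sqr_ge0.
rewrite -lee_fin; apply: le_trans.
apply: (@le_trans _ _ ((s ^+ 2)%:E * (n.+1%:R^-1)%:E)%E).
  rewrite -EFinM lee_fin /s exprVn -invfM.
  by rewrite (_ : 4 * n.+1%:R * L ^+ 2 = (2 * L) ^+ 2 * n.+1%:R) //; ring.
by rewrite lee_wpmul2l // lee_fin sqr_ge0.
Qed.

(** * Comparison with the explicit constant *)

(** The left side is a single term of the exponential series, all of whose terms are nonnegative. *)
Lemma pow_div_fact_le_expR (R : realType) (n : nat) (x : R) :
  0 <= x -> x ^+ n / n`!%:R <= expR x.
Proof.
move=> x0; case: n => [|n].
  by rewrite expr0 fact0 divr1 (le_trans _ (expR_ge1Dx x)) // lerDl.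
by apply: le_trans (expR_ge1Dxn n x0); rewrite lerDr.
Qed.

Unset Implicit Arguments.
Set Strict Implicit.

Theorem corollary1p7 (R : realType) (sigma : probability (measurableTypeR R) R)
    (M : R) (m : nat) (m_gt0 : (0 < m)%N) (xi lambda : 'I_m -> R) :
  sigma `[0, 1]%classic = 1%E ->
  density_ess_bounded sigma M ->
  gaussian_quadrature sigma xi lambda ->
  lambda (Ordinal m_gt0) >=
    1 / (Num.ceil (75 * expR 1 ^+ 4 * (2 * m - 1)%:R * M
                   * (12 * expR 1 * M) ^+ (2 * m - 2)))%:~R.
Proof.
case: m m_gt0 xi lambda => // n m_gt0 xi lambda s01 sM quad.
apply: le_trans (quadrature_weight_lower (Ordinal m_gt0) s01 sM quad).
have M1 := density_ess_bounded_ge1 s01 sM.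
have M0 : 0 < M by apply: lt_le_trans M1.
have e1 : 1 <= expR 1 :> R by rewrite ltW // expR_gt1.
set L := _ / n`!%:R; set X := (X in Num.ceil X); set e := expR 1 in e1 X *.
have e0 : 0 < e by apply: lt_le_trans e1.
have m0 : 0 < n.+1%:R :> R by rewrite ltr0n.
have L0 : 0 < L.
  by rewrite divr_gt0 ?ltr0n ?fact_gt0 // exprn_gt0 // !mulr_gt0.
(* Here m = n+1, and m^n / n! <= e^m = e e^n. *)
have LE : L <= e * (2 * e * M) ^+ n.
  have -> : L = (2 * M) ^+ n * (n.+1%:R ^+ n / n`!%:R).
    by rewrite /L mulrCA exprMn mulrA [X in X / _]mulrC.
  have -> : e * (2 * e * M) ^+ n = (2 * M) ^+ n * expR n.+1%:R.
    have -> : expR n.+1%:R = e ^+ n.+1 by rewrite -[n.+1%:R]mulr1 expRM_natl.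
    by rewrite exprS mulrCA -exprMn [2 * M * e]mulrAC.
  rewrite ler_pM2l ?exprn_gt0 ?mulr_gt0 //.
  exact: pow_div_fact_le_expR.
(* The factors are compared through 4 <= 75, 2 <= 12, e^2 <= e^4, m <= 2m-1 and 1 <= M; the exponent
   2m-2 is 2n. *)
have XL : 4 * n.+1%:R * L ^+ 2 <= X.
  have -> : X = 75 * e ^+ 4 * (2 * n.+1 - 1)%:R * M * ((12 * e * M) ^+ n) ^+ 2.
    by rewrite /X -exprM; congr (_ * _ ^+ _); lia.
  set B := _ ^+ n in LE.
  have B0 : 0 < B by rewrite exprn_gt0 // !mulr_gt0.
  have BC : B <= (12 * e * M) ^+ n.
    by rewrite lerXn2r ?nnegrE ?ler_pM2r ?mulr_ge0 ?ltW ?mulr_gt0 // ltr_nat.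
  have mm : n.+1%:R <= (2 * n.+1 - 1)%:R :> R by rewrite ler_nat; lia.
  apply: (@le_trans _ _ (4 * n.+1%:R * (e * B) ^+ 2)).
    rewrite ler_pM2l ?mulr_gt0 //.
    by rewrite lerXn2r ?nnegrE ?(ltW L0) ?(ltW (mulr_gt0 e0 B0)).
  rewrite exprMn mulrA; apply: ler_pM;
    rewrite ?sqr_ge0 ?mulr_ge0 ?(ltW m0) ?(ltW e0) //.
    have e24 : e ^+ 2 <= e ^+ 4 by rewrite ler_weXn2l.
    have q : e ^+ 2 * n.+1%:R <= e ^+ 4 * (2 * n.+1 - 1)%:R.
      by apply: ler_pM; rewrite ?sqr_ge0 // ltW.
    have q0 : 0 <= e ^+ 2 * n.+1%:R by rewrite mulr_ge0 ?sqr_ge0 // ltW.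
    nra.
  by rewrite lerXn2r ?nnegrE ?(ltW B0) ?(le_trans (ltW B0) BC).
have Y0 : 0 < 4 * n.+1%:R * L ^+ 2.
  by apply: mulr_gt0; [exact: mulr_gt0 | exact: exprn_gt0].
(* Rounding [X] up only enlarges the denominator, so [XL] suffices. *)
rewrite div1r lef_pV2 ?posrE //; last first.
  by rewrite (lt_le_trans Y0) // (le_trans XL) // ceil_ge.
by rewrite (le_trans XL) // ceil_ge.
Qed.
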